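(* For every integer $n\geqslant 2$, the balanced $n$-point correlations of the Thue--Morse system have mean value zero over the nested integer cubes of the first orthant: $$\lim_{N\to\infty}\frac{1}{N^{n-1}}\sum_{0\leqslant m_1,\ldots,m_{n-1}\leqslant N-1}\eta(m_1,\ldots,m_{n-1})=0.$$
   Context: The Thue--Morse sequence $(t_k)_{k\geqslant 0}$ with values $\pm1$ is defined by $t_0=1$, $t_{2k}=t_k$, $t_{2k+1}=-t_k$ for $k\geqslant 0$. Its bi-infinite extension is $w=(w_n)_{n\in\mathbb{Z}}$ with $w_n=t_n$ for $n\geqslant 0$ and $w_n=t_{-n-1}$ for $n<0$. Let $(Sx)_i=x_{i+1}$ be the shift on $\{\pm1\}^{\mathbb{Z}}$ and let $\mathbb{X}=\overline{\{S^iw:i\in\mathbb{Z}\}}\subset\{\pm1\}^{\mathbb{Z}}$ (closure in the product topology). It is a known fact that $(\mathbb{X},\mathbb{Z})$ is strictly ergodic (minimal and uniquely ergodic); $\mu$ denotes its unique shift-invariant probability measure. The (balanced) $n$-point correlations are $$\eta(m_1,\ldots,m_{n-1})=\int_{\mathbb{X}}x_0\,x_{m_1}\cdots x_{m_{n-1}}\,\mathrm{d}\mu(x)=\lim_{N\to\infty}\frac1N\sum_{k=0}^{N-1}t_kt_{k+m_1}\cdots t_{k+m_{n-1}},\qquad m_i\in\mathbb{N}_0.$$ *)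

(* Defs.v *)
From HB Require Import structures.
From mathcomp Require Import all_boot all_order all_algebra.
From mathcomp Require Import all_classical all_reals all_analysis.

Set Implicit Arguments.
Unset Strict Implicit.
Unset Printing Implicit Defensive.

Import Order.TTheory GRing.Theory Num.Theory.
Local Open Scope classical_set_scope.
Local Open Scope ring_scope.

(* The alphabet {+1, -1} is encoded by bool: [false] stands for +1 and [true]
   for -1, so that a letter b has value (-1) ^+ b and negation is a sign
   change. *)

Definition letter (R : pzRingType) (b : bool) : R := (-1) ^+ b.

(* The first argument is fuel; [n] steps are enough, as n./2 < n for n > 0. *)
Fixpoint thue_morse_rec (fuel n : nat) : bool :=
  if fuel is f.+1 then
    if odd n then ~~ thue_morse_rec f n./2 else thue_morse_rec f n./2
  else false.

Definition thue_morse (n : nat) : bool := thue_morse_rec n n.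

Lemma thue_morse_recE f n : (n <= f)%N -> thue_morse_rec f n = thue_morse n.
Proof.
rewrite /thue_morse.
elim/ltn_ind: n f => n IHn [|f]; first by rewrite leqn0 => /eqP ->.
case: n IHn => [|n] IHn le_nf.
  by elim: f.+1 => //= k ->.
rewrite /= -/(uphalf n).
have lt_n : (uphalf n < n.+1)%N by rewrite ltnS leq_uphalf_double -addnn leq_addr.
by rewrite (IHn _ lt_n f (leq_trans lt_n le_nf)) (IHn _ lt_n n lt_n).
Qed.

Lemma thue_morse0 : thue_morse 0 = false.
Proof. by []. Qed.

Lemma thue_morse_double k : thue_morse k.*2 = thue_morse k.
Proof.
rewrite -(@thue_morse_recE k.*2.+1) //= odd_double doubleK.
by rewrite thue_morse_recE // -addnn leq_addr.
Qed.

Lemma thue_morse_doubleS k : thue_morse k.*2.+1 = ~~ thue_morse k.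
Proof.
rewrite /thue_morse /= odd_double /= uphalf_double.
by rewrite thue_morse_recE // -addnn leq_addr.
Qed.

(* [Negz k] is the integer - k - 1. *)
Definition thue_morse_word (i : int) : bool :=
  match i with
  | Posz k => thue_morse k
  | Negz k => thue_morse k
  end.

Definition full_shift : Type := {ptws int -> bool}.

HB.instance Definition _ := Pointed.on full_shift.
HB.instance Definition _ := Topological.on full_shift.

(* The i-th power of the shift, for any integer i. *)
Definition shift_by (i : int) (x : full_shift) : full_shift :=
  fun j => x (j + i).

Definition shift_map : full_shift -> full_shift := shift_by 1.

Definition thue_morse_system : set full_shift :=
  closure (range (fun i : int => shift_by i thue_morse_word)).

Definition borel_full_shift := g_sigma_algebraType (@open full_shift).

(* Borel probability measures on the closed set [thue_morse_system] are
   regarded as Borel probability measures on the full shift for which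
   that set has full measure. *)
Definition invariant_probability (R : realType)
    (mu : probability borel_full_shift R) : Prop :=
  mu thue_morse_system = 1%E /\
  forall A : set borel_full_shift, measurable A -> mu (shift_map @^-1` A) = mu A.

(* The (k+1)-point correlation, with the shifts m_1, ..., m_k indexed
   by 'I_k. *)
Definition correlation (R : realType) (mu : probability borel_full_shift R)
    (k : nat) (m : 'I_k -> nat) : R :=
  \int[mu]_(x in thue_morse_system)
    (letter R (x 0) * \prod_(i < k) letter R (x (m i)%:Z)).

(* Main.v *)
(* Summing over all shifts before integrating gives
     sum_m eta(m) = \int x_0 (x_0 + ... + x_(N-1))^(n-1) dmu.
   Since w_(2k+1) = - w_(2k) for every integer k, the sum of the letters of any
   factor of w, hence of any point of its orbit closure, is at most 2 in
   absolute value, whatever its length; so the mean is at most (2/N)^(n-1) in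
   absolute value. *)

Require Import Defs.
From HB Require Import structures.
From mathcomp Require Import all_boot all_order all_algebra.
From mathcomp Require Import all_classical all_reals all_analysis.
From mathcomp Require Import measurable_realfun.
From mathcomp Require Import zify.

Set Implicit Arguments.
Unset Strict Implicit.
Unset Printing Implicit Defensive.

Import Order.TTheory GRing.Theory Num.Theory.
Import numFieldNormedType.Exports.
Local Open Scope classical_set_scope.
Local Open Scope ring_scope.

Lemma letter_negb (R : pzRingType) (b : bool) : letter R (~~ b) = - letter R b.
Proof. by rewrite /letter signrN. Qed.

Lemma normr_letter (R : numDomainType) (b : bool) : `|letter R b| = 1.
Proof. exact: normr_sign. Qed.

(* P vanishes at even positions, as the letters at 2k and 2k + 1 cancel. *)
Lemma thue_morse_word_primitive (R : pzRingType) (i : int) :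
  let P j := if odd `|j|%N then letter R (thue_morse_word (j - 1)) else 0 in
  letter R (thue_morse_word i) = P (i + 1) - P i.
Proof.
rewrite /=; case: i => k; rewrite -(odd_double_half k);
  case: (odd k); set j := k./2.
- rewrite add1n.
  have -> : j.*2.+1%:Z + 1 = j.+1.*2%:Z by lia.
  have -> : j.*2.+1%:Z - 1 = j.*2%:Z by lia.
  rewrite /= odd_double /= sub0r thue_morse_doubleS letter_negb.
  by rewrite thue_morse_double.
- rewrite add0n.
  have -> : j.*2%:Z + 1 = j.*2.+1%:Z by lia.
  have -> : j.*2.+1%:Z - 1 = j.*2%:Z by lia.
  by rewrite /= odd_double /= subr0.
(* [Negz k] is - k - 1, so on the negative side an odd [k] means an even integer: the cancelling
   pair is [Negz j.*2.+1], [Negz j.*2], in this order. *)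
- rewrite add1n.
  have -> : Negz j.*2.+1 + 1 = Negz j.*2 by rewrite !NegzE; lia.
  have -> : Negz j.*2 - 1 = Negz j.*2.+1 by rewrite !NegzE; lia.
  by rewrite /= odd_double /= subr0.
- rewrite add0n.
  have -> : Negz j.*2 + 1 = - j.*2%:Z by rewrite NegzE; lia.
  have -> : Negz j.*2 - 1 = Negz j.*2.+1 by rewrite !NegzE; lia.
  rewrite abszN /= odd_double sub0r /= thue_morse_double thue_morse_doubleS.
  by rewrite letter_negb opprK.
Qed.

(** The sum telescopes to [P (N + i) - P i], and [P] takes values in {-1, 0, 1}. Uniformity in [i]
    is what lets the bound pass to the orbit closure. *)
Lemma thue_morse_word_discrepancy (R : numDomainType) (i : int) (N : nat) :
  `|\sum_(m < N) letter R (thue_morse_word (m%:Z + i))| <= 2.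
Proof.
pose P j := if odd `|j|%N then letter R (thue_morse_word (j - 1)) else 0.
have P1 j : `|P j| <= 1.
  by rewrite /P; case: ifP => _; rewrite ?normr_letter // normr0.
rewrite (eq_bigr (fun m : 'I_N => P (m.+1%:Z + i) - P (m%:Z + i))); last first.
  move=> m _; have -> : m.+1%:Z + i = m%:Z + i + 1 by rewrite intS -addrA addrC.
  exact: thue_morse_word_primitive.
rewrite -(big_mkord predT (fun m => P (m.+1%:Z + i) - P (m%:Z + i))).
rewrite (telescope_sumr (fun m => P (m%:Z + i))) //.
by rewrite (le_trans (ler_normB _ _)) // -[2]/(1 + 1) lerD.
Qed.

(** The alphabet is discrete, so every one-coordinate cylinder is open. This gives both continuity
    and Borel measurability of the coordinate letters. *)
Lemma open_coordinate (j : int) (A : set bool) :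
  open [set x : full_shift | A (x j)].
Proof.
apply: (@open_comp full_shift bool (fun x => x j)) => //.
  by move=> x _; exact: (@proj_continuous _ (fun=> bool) j).
exact: discrete_open.
Qed.

Lemma continuous_letter_coordinate (R : realType) (j : int) :
  continuous (fun x : full_shift => letter R (x j)).
Proof.
apply/continuousP => A _; exact: (open_coordinate j (letter R @^-1` A)).
Qed.

(** The sum depends continuously on the point, so the bound defines a closed set; this set contains
    all shifts of the Thue-Morse word, hence their closure. *)
Lemma thue_morse_system_discrepancy (R : realType) (x : full_shift) (N : nat) :
  thue_morse_system x -> `|\sum_(m < N) letter R (x m%:Z)| <= 2.
Proof.
pose f (y : full_shift) : R := \sum_(m < N) letter R (y m%:Z).
have cf : continuous f.
  move=> y; apply: cvg_big => [|m _]; first exact: add_continuous.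
  exact: continuous_letter_coordinate.
have clB : closed [set y | `|f y| <= 2].
  apply: (@closed_comp _ _ (fun y => `|f y|) [set r | r <= 2]).
    by move=> y _; apply: cvg_norm; exact: cf.
  exact: closed_le.
have : thue_morse_system `<=` [set y | `|f y| <= 2].
  rewrite /thue_morse_system ((closure_id _).1 clB); apply: closure_subset.
  by move=> _ [i _ <-]; exact: thue_morse_word_discrepancy.
exact.
Qed.

Lemma measurable_thue_morse_system :
  measurable (thue_morse_system : set borel_full_shift).
Proof.
rewrite -[thue_morse_system]setCK; apply: measurableC; apply: sub_sigma_algebra.
exact/closed_openC/closed_closure.
Qed.

Lemma measurable_letter_coordinate (R : realType) (j : int) :
  measurable_fun [set: borel_full_shift] (fun x => letter R (x j)).
Proof.
move=> _ Y _; rewrite setTI; apply: sub_sigma_algebra.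
exact: (open_coordinate j (letter R @^-1` Y)).
Qed.

Lemma Rintegral_sum d (T : measurableType d) (R : realType)
    (mu : measure T R) (D : set T) (mD : measurable D)
    (I : Type) (s : seq I) (F : I -> T -> R) :
  (forall i, mu.-integrable D (EFin \o F i)) ->
  \sum_(i <- s) \int[mu]_(x in D) F i x =
  \int[mu]_(x in D) \sum_(i <- s) F i x.
Proof.
move=> intF; elim: s => [|i s IHs].
  under eq_Rintegral do rewrite big_nil.
  by rewrite big_nil Rintegral_cst // mul0r.
rewrite big_cons IHs -RintegralD //.
  by apply: eq_Rintegral => x _; rewrite big_cons.
rewrite (_ : EFin \o _ = fun x => (\sum_(i <- s) (F i x)%:E)%E).
  by apply: integrable_sum => // ? _; exact: intF.
by apply/funext => x /=; rewrite sumEFin.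
Qed.

(** The integrand is a measurable product of signs, hence bounded by 1, and the measure is
    finite. *)
Lemma integrable_correlation (R : realType)
    (mu : probability borel_full_shift R) (k : nat) (m : 'I_k -> nat) :
  mu.-integrable thue_morse_system
    (EFin \o fun x => letter R (x 0) * \prod_(i < k) letter R (x (m i)%:Z)).
Proof.
apply: measurable_bounded_integrable.
- exact: measurable_thue_morse_system.
- exact: le_lt_trans (probability_le1 _ measurable_thue_morse_system) (ltry 1).
- apply: measurable_funTS; apply: measurable_funM.
    exact: measurable_letter_coordinate.
  by apply: measurable_prod => i _; exact: measurable_letter_coordinate.
- exists 1; split=> // M lt1M x _ /=; apply: le_trans (ltW lt1M).
  rewrite normrM normr_letter normr_prod big1 ?mulr1 // => i _.
  exact: normr_letter.
Qed.

(** After the finite sum is moved under the integral, distributivity applies: expanding the [k]-th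
    power of a sum of [N] letters gives one product for each map from ['I_k] to ['I_N]. *)
Lemma correlation_sum (R : realType) (mu : probability borel_full_shift R)
    (k N : nat) :
  \sum_(m : {ffun 'I_k -> 'I_N}) correlation mu (fun i => m i : nat) =
  \int[mu]_(x in thue_morse_system)
    (letter R (x 0) * (\sum_(j < N) letter R (x j%:Z)) ^+ k).
Proof.
rewrite Rintegral_sum; first last.
- by move=> m; exact: integrable_correlation.
- exact: measurable_thue_morse_system.
apply: eq_Rintegral => x _; rewrite -big_distrr /=; congr (_ * _).
rewrite -(bigA_distr_bigA (fun (i : 'I_k) (j : 'I_N) => letter R (x j%:Z))).
by rewrite prodr_const card_ord.
Qed.

(** The integral of [C] over [D] is [C] times the mass of [D], which is at most 1. *)
Lemma normr_Rintegral_le d (T : measurableType d) (R : realType)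
    (mu : probability T R) (D : set T) (mD : measurable D)
    (f : T -> R) (C : R) :
  measurable_fun D f -> 0 <= C -> (forall x, D x -> `|f x| <= C) ->
  `|\int[mu]_(x in D) f x| <= C.
Proof.
move=> mf C0 fC.
have finD : (mu D < +oo)%E.
  exact: le_lt_trans (probability_le1 _ mD) (ltry 1).
have intf : mu.-integrable D (EFin \o f).
  apply: measurable_bounded_integrable => //.
  exists C; split=> [|M ltCM x Dx /=]; first exact: num_real.
  exact: le_trans (fC x Dx) (ltW ltCM).
apply: le_trans (le_normr_Rintegral mD intf) _.
apply: (@le_trans _ _ (\int[mu]_(x in D) C)).
  apply: le_Rintegral => //; last exact: finite_measure_integrable_cst.
  exact: integrable_norm intf.
rewrite Rintegral_cst // ler_piMr // -lee_fin fineK ?probability_le1 //.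
exact: fin_num_measure.
Qed.

Theorem mainTheorem5 (R : realType) (mu : probability borel_full_shift R)
    (hmu : invariant_probability mu) (n : nat) (hn : (2 <= n)%N) :
  (fun N : nat =>
     (N%:R ^+ n.-1)^-1 *
     \sum_(m : {ffun 'I_n.-1 -> 'I_N})
        correlation mu (fun i : 'I_n.-1 => m i : nat))
    @ \oo --> (0 : R).
Proof.
case: n hn => [|[|k]] // _; rewrite [_.-1]/=.
apply/norm_cvg0P.
(* With [n = k.+2] the exponent [n.-1] is the positive number [k.+1], so the power of a null
   sequence tends to 0. *)
have cvg0 : (fun N : nat => (2 * N%:R^-1 : R) ^+ k.+1) @ \oo --> (0 : R).
  have : (fun N : nat => 2 * N%:R^-1 : R) @ \oo --> (0 : R).
    rewrite -(mulr0 2); apply: cvgMl_tmp.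
    (* The harmonic sequence has terms 1/(N+1), whence the shift of the index. *)
    by rewrite -cvg_shiftS; exact: cvg_harmonic.
  move=> /(continuous_cvg _ (@exprn_continuous R k.+1 0)).
  by rewrite expr0n.
apply: squeeze_cvgr (@cvg_cst _ (0 : R) _ _ _) cvg0.
(* The factor [N^-1 ^+ k.+1] is common to both sides, also for [N = 0] where the inverse is 0; it
   remains to bound the integral by [2 ^+ k.+1]. *)
near=> N; rewrite normr_ge0 /= correlation_sum normrM exprMn.
rewrite normfV normrX normr_nat mulrC -exprVn ler_wpM2r ?exprn_ge0 //.
apply: normr_Rintegral_le.
- exact: measurable_thue_morse_system.
- apply: measurable_funTS; apply: measurable_funM.
    exact: measurable_letter_coordinate.
  apply: measurable_funX; apply: measurable_sum => j.
  exact: measurable_letter_coordinate.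
- exact: exprn_ge0.
- move=> x Xx; rewrite normrM normr_letter mul1r normrX lerXn2r ?nnegrE //.
  exact: thue_morse_system_discrepancy.
Unshelve. all: by end_near.
Qed.
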